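(* Assume that the loss function $\ell:\mathbb{R}^m\to\overline{\mathbb{R}}$ is proper, convex, and lower semicontinuous, and define $\kappa=\sup\{\|\theta\|_*:\ell^*(\theta)<\infty\}$. Then, for any $\varepsilon\ge0$, the worst-case expectation $\sup_{\mathbb{Q}\in\mathbb{B}_\varepsilon(\widehat{\mathbb{P}}_N)}\mathbb{E}^{\mathbb{Q}}[\ell(\xi)]$ is smaller than or equal to $$\kappa\varepsilon+\frac1N\sum_{i=1}^N\ell(\widehat\xi_i).$$ If $\Xi=\mathbb{R}^m$, then the worst-case expectation coincides exactly with $\kappa\varepsilon+\frac1N\sum_{i=1}^N\ell(\widehat\xi_i)$.
   Context: Notation: $\overline{\mathbb{R}}=\mathbb{R}\cup\{-\infty,\infty\}$; $\langle a,b\rangle=a^\top b$; $\|\cdot\|$ is an arbitrary norm on $\mathbb{R}^m$ with dual norm $\|z\|_*=\sup_{\|\xi\|\le1}\langle z,\xi\rangle$. A function $f:\mathbb{R}^m\to\overline{\mathbb{R}}$ is proper if $f(\xi)<+\infty$ for at least one $\xi$ and $f(\xi)>-\infty$ for all $\xi$. Conjugate: $f^*(z)=\sup_{\xi\in\mathbb{R}^m}\langle z,\xi\rangle-f(\xi)$. Conventions of extended arithmetic: $\infty\cdot0=0\cdot\infty=0$ (so $\kappa\varepsilon=0$ if $\kappa=\infty$ and $\varepsilon=0$) and $\infty-\infty=\infty$. Expectations are $\mathbb{E}^{\mathbb{Q}}[\ell(\xi)]=\mathbb{E}^{\mathbb{Q}}[\max\{\ell(\xi),0\}]+\mathbb{E}^{\mathbb{Q}}[\min\{\ell(\xi),0\}]$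 under these conventions. Data and ball: $\Xi\subseteq\mathbb{R}^m$ is the uncertainty set, $\widehat\xi_1,\dots,\widehat\xi_N\in\Xi$ are given points and $\widehat{\mathbb{P}}_N=\frac1N\sum_{i=1}^N\delta_{\widehat\xi_i}$. $\mathcal{M}(\Xi)$ is the set of probability distributions $\mathbb{Q}$ supported on $\Xi$ with $\mathbb{E}^{\mathbb{Q}}[\|\xi\|]<\infty$; $d_{\mathrm W}(\mathbb{Q}_1,\mathbb{Q}_2)=\inf_\Pi\int_{\Xi^2}\|\xi_1-\xi_2\|\,\Pi(d\xi_1,d\xi_2)$ over joint distributions $\Pi$ with marginals $\mathbb{Q}_1,\mathbb{Q}_2$; $\mathbb{B}_\varepsilon(\widehat{\mathbb{P}}_N)=\{\mathbb{Q}\in\mathcal{M}(\Xi):d_{\mathrm W}(\widehat{\mathbb{P}}_N,\mathbb{Q})\le\varepsilon\}$. *)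

(* Defs.v *)
From HB Require Import structures.
From mathcomp Require Import all_boot all_order all_algebra.
From mathcomp Require Import all_classical all_reals all_analysis.

Set Implicit Arguments.
Unset Strict Implicit.
Unset Printing Implicit Defensive.

Import Order.TTheory GRing.Theory Num.Theory.
Import numFieldNormedType.Exports.

Local Open Scope classical_set_scope.
Local Open Scope ring_scope.
Local Open Scope ereal_scope.

(* 'rV[R]_m with its Borel sigma-algebra. The type is convertible to 'rV[R]_m,
   so a function on 'rV[R]_m can be applied to its elements. *)
Definition borel_rV (R : realType) (m : nat) :=
  g_sigma_algebraType (@open 'rV[R]_m).

(* Nonnegativity follows from homogeneity and the triangle inequality. *)
Definition is_norm (R : realType) (m : nat) (nu : 'rV[R]_m -> R) : Prop :=
  [/\ forall x, nu x = 0%R -> x = 0%R,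
      forall (a : R) x, nu (a *: x)%R = (`|a| * nu x)%R
    & forall x y, (nu (x + y) <= nu x + nu y)%R].

Definition inner (R : realType) (m : nat) (a b : 'rV[R]_m) : R :=
  (\sum_i a ord0 i * b ord0 i)%R.

Definition dual_norm (R : realType) (m : nat) (nu : 'rV[R]_m -> R)
    (z : 'rV[R]_m) : \bar R :=
  ereal_sup [set (inner z x)%:E | x in [set x | (nu x <= 1)%R]].

Definition proper_fun (R : realType) (m : nat) (f : 'rV[R]_m -> \bar R) : Prop :=
  (exists x, f x < +oo) /\ (forall x, -oo < f x).

(* The dual addition of extended reals (scope %dE) satisfies +oo - oo = +oo. *)
Definition convex_efun (R : realType) (m : nat) (f : 'rV[R]_m -> \bar R) : Prop :=
  forall (x y : 'rV[R]_m) (t : R), (0 <= t <= 1)%R ->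
    f (t *: x + (1 - t) *: y)%R <= (t%:E * f x + (1 - t)%:E * f y)%dE.

Definition conjugate (R : realType) (m : nat) (f : 'rV[R]_m -> \bar R)
    (z : 'rV[R]_m) : \bar R :=
  ereal_sup (range (fun x : 'rV[R]_m => (inner z x)%:E - f x)).

Definition kappa (R : realType) (m : nat) (nu : 'rV[R]_m -> R)
    (l : 'rV[R]_m -> \bar R) : \bar R :=
  ereal_sup [set dual_norm nu z | z in [set z | conjugate l z < +oo]].

(* The library integral of a function of varying sign subtracts its two parts
   with +oo - oo = -oo, hence the explicit splitting. *)
Definition expect (R : realType) (m : nat) (Q : probability (borel_rV R m) R)
    (l : 'rV[R]_m -> \bar R) : \bar R :=
  (\int[Q]_x maxe (l x) 0 + \int[Q]_x mine (l x) 0)%dE.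

Definition empirical (R : realType) (m N : nat) (xi : 'I_N -> 'rV[R]_m)
    (A : set (borel_rV R m)) : \bar R :=
  (N%:R^-1)%:E * \sum_(i < N) \d_(xi i : borel_rV R m) A.

Section empirical_measure.
Variables (R : realType) (m N : nat) (xi : 'I_N -> 'rV[R]_m).

Let empirical0 : empirical xi set0 = 0.
Proof. by rewrite /empirical big1 ?mule0. Qed.

Let empirical_ge0 A : 0 <= empirical xi A.
Proof.
by apply: mule_ge0; [rewrite lee_fin invr_ge0 | apply: sume_ge0].
Qed.

Let empirical_sigma_additive : semi_sigma_additive (empirical xi).
Proof.
have r0 : (0 <= N%:R^-1 :> R)%R by rewrite invr_ge0.
pose mu (k : nat) : {measure set (borel_rV R m) -> \bar R} :=
  dirac (if insub k is Some i then (xi i : borel_rV R m) else point).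
suff -> : empirical xi = mscale (NngNum r0) (msum mu N).
  exact: measure_semi_sigma_additive.
apply/funext => A; rewrite /empirical /mscale /msum /=; congr (_ * _).
by apply: eq_bigr => i _; rewrite /mu /= valK.
Qed.

HB.instance Definition _ := isMeasure.Build _ _ _ (empirical xi)
  empirical0 empirical_ge0 empirical_sigma_additive.

End empirical_measure.

Definition coupling (R : realType) (m : nat)
    (mu1 mu2 : {measure set (borel_rV R m) -> \bar R})
    (P : probability (borel_rV R m * borel_rV R m)%type R) : Prop :=
  forall A : set (borel_rV R m), measurable A ->
    P (fst @^-1` A) = mu1 A /\ P (snd @^-1` A) = mu2 A.

(* When both marginals are concentrated on Xi, every coupling is concentrated
   on Xi `*` Xi, so the distance does not depend on Xi. *)
Definition wasserstein (R : realType) (m : nat) (nu : 'rV[R]_m -> R)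
    (mu1 mu2 : {measure set (borel_rV R m) -> \bar R}) : \bar R :=
  ereal_inf [set \int[P]_p (nu ((p.1 : 'rV[R]_m) - p.2)%R)%:E
            | P in [set P | coupling mu1 mu2 P]].

(* "Supported on Xi" is read as almost sure membership, which is Q Xi = 1 for a
   Borel set Xi and makes sense for an arbitrary Xi. *)
Definition distributions (R : realType) (m : nat) (nu : 'rV[R]_m -> R)
    (Xi : set 'rV[R]_m) : set (probability (borel_rV R m) R) :=
  [set Q | {ae Q, forall x : borel_rV R m, Xi x} /\ \int[Q]_x (nu x)%:E < +oo].

Definition wball (R : realType) (m N : nat) (nu : 'rV[R]_m -> R)
    (Xi : set 'rV[R]_m) (xi : 'I_N -> 'rV[R]_m) (e : R) :
    set (probability (borel_rV R m) R) :=
  [set Q | distributions nu Xi Q /\ wasserstein nu (empirical xi) Q <= e%:E].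

Definition worst_case (R : realType) (m N : nat) (nu : 'rV[R]_m -> R)
    (Xi : set 'rV[R]_m) (xi : 'I_N -> 'rV[R]_m) (e : R)
    (l : 'rV[R]_m -> \bar R) : \bar R :=
  ereal_sup [set expect Q l | Q in wball nu Xi xi e].

(* Main.v *)
From HB Require Import structures.
Require Import Defs.
From mathcomp Require Import all_boot all_order all_algebra.
From mathcomp Require Import all_classical all_reals all_analysis.
From mathcomp Require Import measurable_realfun ring lra.

(** Write mean for the average of the l(xi_i). Both inequalities rest on the
    description of the loss by its affine minorants <th, .> - c, whose slopes th
    are exactly the points where the conjugate of l is finite.

    Upper bound. If kappa is finite, every slope satisfies
    <th, .> <= kappa * nu, and since a proper convex lower semicontinuous
    function is the supremum of its affine minorants ([affine_minorant_above]),
    l is kappa-Lipschitz for nu ([kappa_lipschitz]). Integrating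
    l(y) <= l(x) + kappa * nu(x - y) against a nearly optimal coupling gives
    E_Q[l] <= mean + kappa * e ([expect_le_wasserstein]). If kappa is infinite
    and e > 0 the bound is trivial. If kappa is infinite and e = 0, then
    kappa * e = 0 and the bound is no longer trivial; but Q, being at distance 0
    from a finitely supported measure, lives on the data points
    ([wasserstein_eq0]), where any real-valued function is Lipschitz
    ([data_slope]), so that the same integration applies.

    Lower bound, for Xi the whole space. Move the fraction s of the mass of each
    data point by (e / s) u, where nu(u) <= 1; this costs at most e. An affine
    minorant with slope th bounds the expectation after the move from below by
    mean + e * <th, u> + O(s). Let s tend to 0 and take the supremum over u,
    then over th ([worst_case_ge]).

    Supremum of affine minorants. Separation of convex sets is replaced by the
    proximal construction: minimise l + k |. - x|^2 over a compact box. A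
    minimiser z in the interior yields the subgradient 2k (x - z) of l at z
    ([local_prox_subgradient]). For x in the domain and l bounded below near x
    this already produces one affine minorant. That minorant makes the penalised
    problem coercive at an arbitrary x, even one far from the domain, and when k
    grows the values at x of the affine minorants obtained in this way reach any
    number below l(x). *)

Set Implicit Arguments.
Unset Strict Implicit.
Unset Printing Implicit Defensive.

Import Order.TTheory GRing.Theory Num.Theory.
Import numFieldNormedType.Exports.

Local Open Scope classical_set_scope.
Local Open Scope ring_scope.
Local Open Scope ereal_scope.

(** * Lower semicontinuity and the Euclidean inner product *)

(** The sublevel sets above the infimum generate a filter on K; lower
    semicontinuity turns any cluster point of it into a minimiser. *)
Lemma lsc_compact_min {X : topologicalType} {R : realType}
    (f : X -> \bar R) (K : set X) :
  lower_semicontinuous f -> compact K -> K !=set0 ->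
  exists2 p, K p & forall z, K z -> f p <= f z.
Proof.
move=> lscf cK [x0 Kx0].
pose i := ereal_inf (f @` K).
have [fi|ix0] := leP (f x0) i.
  exists x0 => // z Kz; apply: (le_trans fi); apply: ereal_inf_lbound.
  by exists z.
pose lev (c : \bar R) := K `&` [set z | f z <= c].
pose F := filter_from [set c : \bar R | i < c] lev.
have FF : Filter F.
  apply: filter_from_filter; first by exists (f x0).
  move=> a b ia ib; exists (mine a b); first by rewrite /= lt_min; apply/andP.
  by move=> z [Kz]; rewrite /= le_min => /andP[za zb].
have PF : ProperFilter F.
  apply: filter_from_proper => // c ic.
  have [_ [z Kz <-] zc] := ereal_inf_lt ic.
  by exists z; split => //; exact: ltW.
have FK : F K by exists (f x0) => // z [].
have [p [Kp clp]] := cK F PF FK.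
exists p => // z Kz.
suff pi : f p <= i by apply: (le_trans pi); apply: ereal_inf_lbound; exists z.
rewrite leNgt; apply/negP => ip.
(* Lower semicontinuity tests real levels only, and i or f p may be infinite. *)
have [c /andP[ic cp]] : exists c : R, (i < c%:E < f p).
  move: ip; case: (i) => [a| |]; case: (f p) => [b| |] //= ab.
  - exists ((a + b) / 2)%R; rewrite !lte_fin; move: ab; rewrite lte_fin => ab.
    by apply/andP; split; lra.
  - by exists (a + 1)%R; rewrite lte_fin ltry; apply/andP; split=> //; lra.
  - by exists (b - 1)%R; rewrite lte_fin ltNyr; apply/andP; split=> //; lra.
  - by exists 0%R; rewrite ltry ltNyr.
have [V nV Vc] := lscf p c cp.
have Fc : F (lev c%:E) by exists c%:E.
have [y [[_ yc] /Vc cy]] := clp _ _ Fc nV.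
by move: (lt_le_trans cy yc); rewrite ltxx.
Qed.

Lemma lsc_addr {X : topologicalType} {R : realType} (f : X -> \bar R)
    (g : X -> R) :
  lower_semicontinuous f -> continuous g ->
  lower_semicontinuous (fun x => f x + (g x)%:E).
Proof.
move=> lscf cg x a afg.
have [b /andP[afb bf]] : exists b : R, (a - g x < b)%R && (b%:E < f x).
  move: afg; case: (f x) => [r| |] //=.
    rewrite -EFinD lte_fin => h; exists ((a - g x + r) / 2)%R.
    by rewrite lte_fin; apply/andP; split; lra.
  by exists (a - g x + 1)%R; rewrite ltry andbT; lra.
have [V nV Vb] := lscf x b bf.
have ng : nbhs x [set y | (a - b < g y)%R].
  have agx : (a - b < g x)%R by lra.
  exact: (cg x _ (lt_nbhsr agx)).
exists (V `&` [set y | (a - b < g y)%R]); first exact: filterI.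
move=> y [/Vb by_ gy]; rewrite /= in gy.
rewrite -lteBlDr//; apply: le_lt_trans by_.
by rewrite -EFinB lee_fin; lra.
Qed.

Section inner_product.
Context {R : realType} {m : nat}.
Implicit Types x y z : 'rV[R]_m.
Local Open Scope ring_scope.

Lemma innerC x y : inner x y = inner y x.
Proof. by apply: eq_bigr => i _; rewrite mulrC. Qed.

Lemma innerDr x y z : inner x (y + z) = inner x y + inner x z.
Proof. by rewrite -big_split; apply: eq_bigr => i _; rewrite mxE mulrDr. Qed.

Lemma innerZr x (a : R) y : inner x (a *: y) = a * inner x y.
Proof. by rewrite mulr_sumr; apply: eq_bigr => i _; rewrite mxE mulrCA. Qed.

Lemma innerNr x y : inner x (- y) = - inner x y.
Proof. by rewrite -scaleN1r innerZr mulN1r. Qed.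

Lemma innerBr x y z : inner x (y - z) = inner x y - inner x z.
Proof. by rewrite innerDr innerNr. Qed.

Lemma innerZl (a : R) x y : inner (a *: x) y = a * inner x y.
Proof. by rewrite innerC innerZr innerC. Qed.

Lemma innerDl x y z : inner (x + y) z = inner x z + inner y z.
Proof. by rewrite innerC innerDr !(innerC z). Qed.

Lemma inner_ge0 x : 0 <= inner x x.
Proof. by apply: sumr_ge0 => i _; rewrite -expr2 sqr_ge0. Qed.

Lemma inner_sqrD x y :
  inner (x + y) (x + y) = inner x x + 2 * inner x y + inner y y.
Proof. by rewrite innerDr !innerDl (innerC y x); ring. Qed.

Lemma coord_sqr_le x i : x ord0 i ^+ 2 <= inner x x.
Proof.
rewrite /inner (bigD1 i)//= -expr2 lerDl; apply: sumr_ge0 => j _.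
by rewrite -expr2 sqr_ge0.
Qed.

(** Young's inequality, from |th / (2k) + y|^2 >= 0. *)
Lemma inner_young (k : R) x y : 0 < k ->
  - inner x y <= k * inner y y + inner x x / (4 * k).
Proof.
move=> k0; have := inner_ge0 ((2 * k)^-1 *: x + y).
rewrite inner_sqrD !innerZl !innerZr => h.
rewrite -subr_ge0; have := mulr_ge0 (ltW k0) h.
by congr (0 <= _); field; rewrite gt_eqF.
Qed.

Lemma inner_self_continuous x0 : continuous (fun z => inner (z - x0) (z - x0)).
Proof.
rewrite /inner; apply: continuous_big => [|i _]; first exact: add_continuous.
have ci : continuous (fun z : 'rV[R]_m => z ord0 i - x0 ord0 i).
  move=> z; have ci := @coord_continuous R 1 m ord0 i z.
  exact: cvgB ci (cvg_cst _).
have -> : (fun z => (z - x0) ord0 i * (z - x0) ord0 i) =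
    (fun z => (z ord0 i - x0 ord0 i) * (z ord0 i - x0 ord0 i)).
  by apply/funext => z; rewrite !mxE.
by move=> z; exact: cvgM (ci z) (ci z).
Qed.

Lemma box_compact x0 (r : R) :
  compact [set z : 'rV[R]_m | forall i, `|z ord0 i - x0 ord0 i| <= r].
Proof.
have := @rV_compact R m (fun i => `[x0 ord0 i - r, x0 ord0 i + r]%classic)
  (fun i => @segment_compact _ _ _).
congr compact; apply/seteqP; split => z zb i; have := zb i;
  by rewrite /= in_itv/= ler_distl.
Qed.

End inner_product.

(** * Subgradients from a quadratic penalty *)

Section penalised_minimum.
Context {R : realType} {m : nat}.
Implicit Types (l : 'rV[R]_m -> \bar R) (x y z w : 'rV[R]_m).

Lemma coord_le_of_inner x (r : R) :
  (0 <= r)%R -> (inner x x <= r ^+ 2)%R -> forall i, (`|x ord0 i| <= r)%R.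
Proof.
move=> r0 xr i; rewrite -(@ler_pXn2r _ 2)// ?nnegrE// -normrX ger0_norm ?sqr_ge0//.
exact: le_trans (coord_sqr_le x i) xr.
Qed.

Lemma nbhs_box x (V : set 'rV[R]_m) : nbhs x V ->
  exists2 r : R, (0 < r)%R &
    forall z, (forall i, `|(z - x) ord0 i| <= r)%R -> V z.
Proof.
move=> /nbhs_ballP[e /= e0 eV]; exists (e / 2)%R; first by rewrite divr_gt0.
move=> z zx; apply: eV; split => // i j; rewrite ord1 /ball/= distrC.
have := zx j; rewrite !mxE; move/le_lt_trans; apply.
by rewrite ltr_pdivrMr// ltr_pMr// ltr1n.
Qed.

(** First-order conditions are read off by letting t tend to 0. *)
Lemma ge0_of_small_steps (c d t0 : R) : (0 < t0)%R -> (0 <= d)%R ->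
  (forall t, 0 < t <= t0 -> 0 <= c + t * d)%R -> (0 <= c)%R.
Proof.
move=> t00 d0 h; rewrite leNgt; apply/negP => c0.
pose t := Num.min t0 (- c / (2 * (d + 1)))%R.
have d1 : (0 < 2 * (d + 1))%R by lra.
have t0' : (0 < t)%R by rewrite lt_min t00/= divr_gt0//; lra.
have := h t; rewrite t0' ge_min lexx => /(_ isT).
have : (t * (2 * (d + 1)) <= - c)%R.
  by rewrite -ler_pdivlMr// ge_min lexx orbT.
nra.
Qed.

Lemma small_step_inner (x d : 'rV[R]_m) (r : R) : (inner x x < r ^+ 2)%R ->
  exists2 t0 : R, (0 < t0 <= 1)%R & forall t, (0 < t <= t0)%R ->
    (inner (x + t *: d) (x + t *: d) <= r ^+ 2)%R.
Proof.
move=> xr; pose D := (2 * `|inner x d| + inner d d + 1)%R.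
have D0 : (0 < D)%R.
  by have := inner_ge0 d; have := normr_ge0 (inner x d); rewrite /D; lra.
(* For t <= 1 the increase 2t<x,d> + t^2|d|^2 is at most t D. *)
exists (Num.min 1 ((r ^+ 2 - inner x x) / D))%R.
  by rewrite lt_min ltr01 divr_gt0 ?subr_gt0//= ge_min lexx.
move=> t /andP[t0]; rewrite le_min => /andP[t1]; rewrite ler_pdivlMr// => tD.
rewrite inner_sqrD !innerZr !innerZl.
have := inner_ge0 d; have := ler_norm (inner x d); have := normr_ge0 (inner x d).
rewrite /D in tD; move: tD xr.
set P := inner x d; set Q := inner d d; set A := `|P|%R; set S := inner x x.
set r2 := (r ^+ 2)%R; move=> tD Sr A0 PA Q0.
have h1 : (t * P <= t * A)%R by rewrite ler_pM2l.
have h2 : (t * (t * Q) <= t * Q)%R by rewrite ler_pM2l// ler_piMl.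
nra.
Qed.

(** Let z minimise h = l + k |. - x0|^2 over the box of radius r around x0. The
    hypothesis on h(y0) keeps z away from the Euclidean sphere of radius r, so
    that z can be moved slightly towards any w inside the box. Comparing h at z
    and at z + t (w - z), with convexity for l and an expansion of the square,
    gives the subgradient inequality with an error O(t). Minimality holds
    in the box only, but by convexity the resulting inequality is global. *)
Lemma local_prox_subgradient l x0 y0 (k r : R) :
    proper_fun l -> convex_efun l -> lower_semicontinuous l ->
    (0 < k)%R -> (0 < r)%R ->
    (forall i, `|(y0 - x0) ord0 i| <= r)%R -> l y0 < +oo ->
    (forall z, (forall i, `|(z - x0) ord0 i| <= r)%R ->
      (r ^+ 2 <= inner (z - x0) (z - x0))%R ->
      l y0 + (k * inner (y0 - x0) (y0 - x0))%:E
        < l z + (k * inner (z - x0) (z - x0))%:E) ->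
  exists z (a : R), [/\ l z = a%:E &
    forall w, (a + 2 * k * inner (x0 - z) (w - z))%:E <= l w].
Proof.
move=> [_ lNy] cvx lsc k0 r0 y0r ly0 bd.
pose h z := l z + (k * inner (z - x0) (z - x0))%:E.
have lsch : lower_semicontinuous h.
  apply: lsc_addr => // z; have := @inner_self_continuous R m x0 z.
  by move=> c; exact: cvgM (cvg_cst _) c.
pose K := [set z : 'rV[R]_m | forall i, (`|z ord0 i - x0 ord0 i| <= r)%R].
have KE z : K z <-> forall i, (`|(z - x0) ord0 i| <= r)%R.
  by split => + i => /(_ i); rewrite !mxE.
have Ky0 : K y0 by apply/KE.
have [z Kz zmin] := lsc_compact_min lsch (@box_compact R m x0 r) (ex_intro _ _ Ky0).
have hzy : h z <= h y0 by exact: zmin.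
have lzoo : l z < +oo.
  rewrite ltey; apply: contraTneq hzy => lz.
  by rewrite /h lz addye// -ltNge lte_add_pinfty// ltry.
have zr : (inner (z - x0) (z - x0) < r ^+ 2)%R.
  rewrite ltNge; apply/negP => /bd; move/KE : Kz => Kz /(_ Kz).
  by rewrite ltNge hzy.
have [a la] : exists a : R, l z = a%:E.
  by exists (fine (l z)); rewrite fineK// fin_numE gt_eqF// lt_eqF.
exists z, a; split => // w.
have [->|lw] := eqVneq (l w) +oo; first by rewrite leey.
have [b lb] : exists b : R, l w = b%:E.
  by exists (fine (l w)); rewrite fineK// fin_numE gt_eqF// lw.
rewrite lb lee_fin; pose d := (w - z)%R.
have [t0 /andP[t00 t01] ht0] := small_step_inner d zr.
rewrite -subr_ge0; apply: (@ge0_of_small_steps _ (k * inner d d) t0) => //.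
  by rewrite mulr_ge0 ?inner_ge0// ltW.
move=> t /andP[tp tt0].
pose zt := (t *: w + (1 - t) *: z)%R.
have ztE : (zt - x0 = (z - x0) + t *: d)%R.
  by rewrite /zt /d scalerBl scalerBr scale1r; apply/rowP => i; rewrite !mxE; ring.
have Kzt : K zt.
  apply/KE; apply: coord_le_of_inner; first exact: ltW.
  by rewrite ztE; apply: ht0; rewrite tp.
have t1 : (t <= 1)%R by lra.
have := cvx w z t; rewrite (ltW tp) t1 lb la => /(_ isT).
rewrite -/zt => cv.
have {}cv : l zt <= (t * b + (1 - t) * a)%:E by [].
have := le_trans (zmin _ Kzt) (leeD2r (k * inner (zt - x0) (zt - x0))%:E cv).
rewrite /h la.
rewrite -!EFinD lee_fin ztE (inner_sqrD (z - x0)%R (t *: d)) !innerZr !innerZl -/d => key.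
have -> : inner (x0 - z) d = (- inner (z - x0) d)%R.
  by rewrite -opprB innerC innerNr innerC.
by rewrite -(pmulr_rge0 _ tp); move: key; rewrite -subr_ge0; congr (0 <= _)%R; ring.
Qed.

End penalised_minimum.

(** * Affine minorants, the conjugate and the dual norm *)

Section affine_minorants.
Context {R : realType} {m : nat} (l : 'rV[R]_m -> \bar R).
Hypotheses (proper_l : proper_fun l) (convex_l : convex_efun l)
  (lsc_l : lower_semicontinuous l).
Implicit Types (x y z w : 'rV[R]_m).

Lemma proper_point : exists y (b : R), l y = b%:E.
Proof.
have [[y ly] lNy] := proper_l; exists y, (fine (l y)).
by rewrite fineK// fin_numE gt_eqF// lt_eqF.
Qed.

(** By lower semicontinuity l > l(y) - 1 on a box of radius r around a point y of
    the domain; the penalty |. - y|^2 / r^2 compensates this 1 at Euclidean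
    distance at least r. *)
Lemma affine_minorant_exists :
  exists th (c : R), forall w, (inner th w - c)%:E <= l w.
Proof.
have [y [b ly]] := proper_point.
have [V nV Vl] : exists2 V, nbhs y V & forall z, V z -> (b - 1)%:E < l z.
  by apply: lsc_l; rewrite ly lte_fin; lra.
have [r r0 rV] := nbhs_box nV.
have r20 : (0 < r ^+ 2)%R by rewrite exprn_gt0.
have k0 : (0 < (r ^+ 2)^-1)%R by rewrite invr_gt0.
have [|||z [a [lz h]]] := local_prox_subgradient proper_l convex_l lsc_l k0 r0
    (x0 := y) (y0 := y).
- by move=> i; rewrite subrr mxE normr0 ltW.
- by rewrite ly ltry.
- move=> z /rV/Vl lz rz; rewrite ly subrr /inner big1 ?mulr0 ?adde0; last first.
    by move=> i _; rewrite !mxE mul0r.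
  rewrite -(lteD2rE _ _ (x := ((r ^+ 2)^-1 * inner (z - y) (z - y))%:E))// in lz.
  apply: le_lt_trans lz; rewrite -EFinD lee_fin.
  suff : (1 <= (r ^+ 2)^-1 * inner (z - y) (z - y))%R by lra.
  by rewrite mulrC ler_pdivlMr// mul1r.
exists (2 * (r ^+ 2)^-1 *: (y - z))%R,
  (2 * (r ^+ 2)^-1 * inner (y - z) z - a)%R => w.
apply: le_trans (h w); rewrite lee_fin innerBr innerZl; lra.
Qed.

(** A large penalty k forces h = l + k |. - x|^2 to be at least a everywhere:
    near x because l > a there, elsewhere because the quadratic term dominates
    the affine minorant already available. The affine minorant attached to the
    minimiser z of h has at x the value l(z) + 2k |x - z|^2 >= h(z) >= a. *)
Lemma affine_minorant_above x (a : R) : a%:E < l x ->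
  exists th (c : R), (forall w, (inner th w - c)%:E <= l w) /\
    (a <= inner th x - c)%R.
Proof.
move=> alx.
have [y [b ly]] := proper_point.
have [th [c thc]] := affine_minorant_exists.
have [V nV Vl] := lsc_l alx.
have [r r0 rV] := nbhs_box nV.
have r20 : (0 < r ^+ 2)%R by rewrite exprn_gt0.
pose T := inner th th; pose C0 := (inner th x - c)%R.
have T0 : (0 <= T)%R by exact: inner_ge0.
(* With this k, k/2 * r^2 >= |a - C0| + T, so that [below] yields [far]. *)
pose k := (1 + 2 * (`|a - C0| + T) / r ^+ 2)%R.
have k1 : (1 <= k)%R by rewrite lerDl divr_ge0// ?mulr_ge0// ?addr_ge0// ltW.
have k0 : (0 < k)%R by lra.
have below z : (C0 - T / 2 + k / 2 * inner (z - x) (z - x))%:E <=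
    l z + (k * inner (z - x) (z - x))%:E.
  apply: le_trans (leeD2r _ (thc z)); rewrite -EFinD lee_fin.
  have k20 : (0 < k / 2)%R by lra.
  have := inner_young th (z - x)%R k20; rewrite innerBr -/T.
  have : (T / (4 * (k / 2)) <= T / 2)%R.
    by apply: ler_wpM2l => //; rewrite lef_pV2 ?posrE; lra.
  rewrite /C0; lra.
have far z : (r ^+ 2 <= inner (z - x) (z - x))%R ->
    a%:E <= l z + (k * inner (z - x) (z - x))%:E.
  move=> rz; apply: le_trans (below z); rewrite lee_fin.
  have : (k / 2 * r ^+ 2 <= k / 2 * inner (z - x) (z - x))%R.
    by rewrite ler_pM2l//; lra.
  have -> : (k / 2 * r ^+ 2 = r ^+ 2 / 2 + (`|a - C0| + T))%R.
    by rewrite /k; field; rewrite gt_eqF.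
  have := ler_norm (a - C0)%R; lra.
have above z : a%:E <= l z + (k * inner (z - x) (z - x))%:E.
  have [/far//|zr] := leP (r ^+ 2)%R (inner (z - x) (z - x)).
  have Vz : V z by apply: rV; apply: coord_le_of_inner; exact: ltW.
  apply: (le_trans (ltW (Vl z Vz))); rewrite leeDl// lee_fin.
  by rewrite mulr_ge0 ?inner_ge0// ltW.
(* The box has to contain y, and h has to exceed v = h(y) beyond radius s. *)
pose v := (b + k * inner (y - x) (y - x))%R.
pose s := (1 + inner (y - x) (y - x) + 2 * (`|v - C0| + T))%R.
have Q0 := inner_ge0 (y - x)%R.
have v0 := normr_ge0 (v - C0)%R.
have s1 : (1 <= s)%R by rewrite /s; lra.
have ss : (s <= s ^+ 2)%R by rewrite expr2 ler_peMl//; lra.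
have [|||||z [a' [lz h]]] := local_prox_subgradient proper_l convex_l lsc_l
    (k := k) (r := s) (x0 := x) (y0 := y).
- by [].
- by lra.
- by apply: coord_le_of_inner; [lra|apply: le_trans ss; rewrite /s; lra].
- by rewrite ly ltry.
- move=> z _ sz; apply: lt_le_trans (below z); rewrite ly -EFinD lte_fin -/v.
  have : (s <= k * inner (z - x) (z - x))%R.
    apply: (le_trans ss); apply: (le_trans sz); rewrite ler_peMl//.
    exact: inner_ge0.
  have := ler_norm (v - C0)%R; rewrite /s => ? ?; lra.
exists (2 * k *: (x - z))%R, (2 * k * inner (x - z) z - a')%R; split => [w|].
  by apply: le_trans (h w); rewrite lee_fin innerBr innerZl; lra.
have := above z; rewrite lz -EFinD lee_fin => /le_trans; apply.
rewrite innerZl.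
have -> : inner (z - x) (z - x) = inner (x - z) (x - z).
  by rewrite -(opprB x z) innerNr innerC innerNr opprK.
have := mulr_ge0 (ltW k0) (inner_ge0 (x - z)%R).
have := innerBr (x - z)%R x z => E; rewrite E; lra.
Qed.

Lemma conjugate_lt_pinfty th (c : R) :
  (forall w, (inner th w - c)%:E <= l w) -> conjugate l th < +oo.
Proof.
move=> thc; apply: (@le_lt_trans _ _ c%:E); last exact: ltry.
apply: ge_ereal_sup => _ [w _ <-]; have := thc w.
by case: (l w) => [b| |] //=; rewrite -?EFinB ?lee_fin ?leNye//; lra.
Qed.

Lemma conjugate_minorant th : conjugate l th < +oo ->
  exists c : R, forall w, (inner th w - c)%:E <= l w.
Proof.
move=> cth; have [y [b ly]] := proper_point.
have ub w : (inner th w)%:E - l w <= conjugate l th.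
  by apply: ereal_sup_ubound; exists w.
have [c Ec] : exists c : R, conjugate l th = c%:E.
  exists (fine (conjugate l th)); rewrite fineK// fin_numE (lt_eqF cth) andbT.
  by have := ub y; rewrite ly -EFinB; apply: contraTneq => ->.
exists c => w; have := ub w; rewrite Ec; have := proper_l.2 w.
by case: (l w) => [x| |] //=; rewrite -?EFinB ?lee_fin ?leey//; lra.
Qed.

Context (nu : 'rV[R]_m -> R).
Hypothesis norm_nu : is_norm nu.

Lemma is_norm0 : nu 0%R = 0%R.
Proof.
case: norm_nu => _ nuZ _; have := nuZ 0%R 0%R.
by rewrite scale0r normr0 mul0r.
Qed.

Lemma is_normN x : nu (- x)%R = nu x.
Proof. by case: norm_nu => _ nuZ _; rewrite -scaleN1r nuZ normrN1 mul1r. Qed.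

Lemma is_norm_ge0 x : (0 <= nu x)%R.
Proof.
case: norm_nu => _ _ /(_ x (- x)%R); rewrite subrr is_norm0 is_normN; lra.
Qed.

Lemma dual_norm_ge0 z : 0 <= dual_norm nu z.
Proof.
apply: ereal_sup_ubound; exists 0%R; first by rewrite /= is_norm0.
by rewrite /inner big1// => i _; rewrite mxE mulr0.
Qed.

Lemma inner_le_dual_norm z x (K : R) :
  dual_norm nu z <= K%:E -> (inner z x <= K * nu x)%R.
Proof.
move=> zK; case: (norm_nu) => nu0 nuZ _.
have [nx0|nx0] := eqVneq (nu x) 0%R.
  rewrite nx0 (nu0 _ nx0) mulr0 /inner big1// => i _.
  by rewrite mxE mulr0.
have nxp : (0 < nu x)%R by rewrite lt_neqAle eq_sym nx0 is_norm_ge0.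
have := le_trans _ zK; move=> /(_ (inner z ((nu x)^-1 *: x))%:E).
rewrite lee_fin innerZr mulrC ler_pdivrMr//; apply.
apply: ereal_sup_ubound; exists ((nu x)^-1 *: x)%R => //=.
  by rewrite nuZ ger0_norm ?invr_ge0 ?is_norm_ge0// mulVf.
by rewrite innerZr mulrC.
Qed.

(** The set of slopes is nonempty, hence kappa is not the supremum of the
    empty set. *)
Lemma kappa_ge0 : 0 <= kappa nu l.
Proof.
have [th [c /conjugate_lt_pinfty thoo]] := affine_minorant_exists.
by apply: (le_trans (dual_norm_ge0 th)); apply: ereal_sup_ubound; exists th.
Qed.

(** Otherwise some affine minorant of l would exceed l(y) + kappa nu(x - y) at x
    while being at most l(y) at y, so its slope would have dual norm larger
    than kappa. The point x may lie outside the domain of l. *)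
Lemma kappa_lipschitz (K : R) x y : kappa nu l = K%:E ->
  l x <= l y + (K * nu (x - y))%:E.
Proof.
move=> kK; rewrite leNgt; apply/negP => lyx.
have [b ly] : exists b : R, l y = b%:E.
  have := proper_l.2 y; case: (l y) lyx => [b| |]//; first by exists b.
  by rewrite addye// => /lt_le_trans/(_ (leey _)); rewrite ltxx.
move: lyx; rewrite ly -EFinD => blx.
have [a /andP[ba alx]] : exists a : R,
    (b + K * nu (x - y)%R < a)%R && (a%:E < l x).
  move: blx; case: (l x) => [r| |] //=.
    rewrite lte_fin => h; exists ((b + K * nu (x - y) + r) / 2)%R.
    by rewrite lte_fin; apply/andP; split; lra.
  by exists (b + K * nu (x - y) + 1)%R; rewrite ltry andbT; lra.
have [th [c [thc tha]]] := affine_minorant_above alx.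
have thK : dual_norm nu th <= K%:E.
  rewrite -kK; apply: ereal_sup_ubound; exists th => //.
  exact: conjugate_lt_pinfty thc.
have := inner_le_dual_norm (x - y)%R thK; rewrite innerBr.
have := thc y; rewrite ly lee_fin; lra.
Qed.

End affine_minorants.

(** * Borel measurability on row vectors *)

Section borel_measurability.
Context {R : realType} {m : nat}.
Implicit Types (x y z w : 'rV[R]_m).

Lemma lsc_borel_measurable (f : 'rV[R]_m -> \bar R) :
  lower_semicontinuous f ->
  measurable_fun [set: borel_rV R m] (f : borel_rV R m -> \bar R).
Proof.
move=> /lower_semicontinuousP lscf.
apply: (measurability _ (ErealGenOInfty.measurableE R)).
move=> _ [_ [a ->] <-]; apply: measurableI => //.
rewrite preimage_itvoy; apply: sub_sigma_algebra; exact: lscf.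
Qed.

Lemma continuous_borel_measurable (f : 'rV[R]_m -> R) :
  continuous f -> measurable_fun [set: borel_rV R m] (fun x : borel_rV R m => (f x)%:E).
Proof.
move=> cf; apply: lsc_borel_measurable => x a; rewrite lte_fin => afx.
exists [set y | (a < f y)%R]; first exact: (cf x _ (lt_nbhsr afx)).
by move=> y; rewrite lte_fin.
Qed.

Context (nu : 'rV[R]_m -> R).
Hypothesis norm_nu : is_norm nu.

Lemma is_norm_sum (I : Type) (r : seq I) (F : I -> 'rV[R]_m) :
  (nu (\sum_(i <- r) F i) <= \sum_(i <- r) nu (F i))%R.
Proof.
elim: r => [|i r ih]; first by rewrite !big_nil (is_norm0 norm_nu).
rewrite !big_cons; case: norm_nu => _ _ nuD.
by apply: le_trans (nuD _ _) _; rewrite lerD2l.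
Qed.

Lemma is_norm_coord_small (e : R) : (0 < e)%R ->
  exists2 d : R, (0 < d)%R &
    forall x, (forall i, `|x ord0 i| <= d)%R -> (nu x < e)%R.
Proof.
move=> e0.
pose C := (\sum_(i < m) nu (delta_mx ord0 i) + 1)%R.
have C0 : (0 < C)%R.
  by rewrite ltr_wpDl// sumr_ge0// => i _; exact: is_norm_ge0.
exists (e / C)%R => [|x xd]; first by rewrite divr_gt0.
rewrite [x]row_sum_delta; apply: le_lt_trans (is_norm_sum _ _) _.
apply: (@le_lt_trans _ _ (e / C * (C - 1))%R).
  rewrite /C addrK mulr_sumr; apply: ler_sum => i _.
  case: (norm_nu) => _ -> _; apply: ler_wpM2r; first exact: is_norm_ge0.
  exact: xd.
by rewrite mulrBr mulr1 divfK ?gt_eqF// ltrBlDr ltrDl divr_gt0.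
Qed.

Lemma is_norm_lipschitz x y : (`|nu x - nu y| <= nu (x - y))%R.
Proof.
case: (norm_nu) => _ _ nuD.
have := nuD (x - y)%R y; have := nuD (y - x)%R x; rewrite !subrK.
rewrite -[nu (y - x)%R](is_normN norm_nu) opprB ler_norml; lra.
Qed.

Lemma is_norm_continuous y : continuous (fun x => nu (x - y)%R).
Proof.
move=> x A /nbhs_ballP[e /= e0 eA]; have [d d0 dnu] := is_norm_coord_small e0.
apply/nbhs_ballP; exists d => //= z [_ xz]; apply: eA; rewrite /ball/=.
apply: (le_lt_trans (is_norm_lipschitz _ _)).
rewrite opprD opprK addrACA addNr addr0; apply: dnu => i; rewrite !mxE.
exact/ltW/xz.
Qed.

Lemma rational_dense x (e : R) : (0 < e)%R ->
  exists q : 'rV[rat]_m, (nu (x - map_mx ratr q)%R < e)%R.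
Proof.
move=> /is_norm_coord_small[d d0 dnu].
have /choice[q qx] : forall i : 'I_m, exists q : rat, (`|x ord0 i - ratr q| <= d)%R.
  move=> i; have [|q] := @rat_in_itvoo R (x ord0 i - d)%R (x ord0 i + d)%R.
    by lra.
  rewrite in_itv/= => /andP[q1 q2]; exists q; rewrite ler_norml.
  by apply/andP; split; lra.
by exists (\row_i q i)%R; apply: dnu => i; rewrite !mxE.
Qed.

(** Continuity on the product space does not suffice by itself, because the
    product sigma-algebra is generated by rectangles. Instead, nu(x - y) < a holds iff
    nu(x - q) + nu(y - q) < a for some rational vector q: this is a countable
    union, and each summand depends on one of the two variables only. *)
Lemma measurable_norm_diff : measurable_fun [set: borel_rV R m * borel_rV R m]
  (fun p => (nu ((p.1 : 'rV[R]_m) - p.2)%R)%:E).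
Proof.
apply: (measurability _ (ErealGenInftyO.measurableE R)).
move=> _ [_ [a ->] <-]; rewrite setTI preimage_itvNyo.
have mnu q : measurable_fun [set: borel_rV R m * borel_rV R m]
    (fun p => (nu ((p.1 : 'rV[R]_m) - q)%R)%:E + (nu ((p.2 : 'rV[R]_m) - q)%R)%:E).
  have mq := continuous_borel_measurable (@is_norm_continuous q).
  by apply: emeasurable_funD; apply: (measurableT_comp mq).
rewrite [X in measurable X](_ : _ = \bigcup_(q : 'rV[rat]_m)
  [set p : borel_rV R m * borel_rV R m |
    (nu ((p.1 : 'rV[R]_m) - map_mx ratr q)%R)%:E +
    (nu ((p.2 : 'rV[R]_m) - map_mx ratr q)%R)%:E < a%:E]).
  apply: countable_bigcupT_measurable; first exact: countableP.
  by move=> q; rewrite -[X in measurable X]setTI; exact: emeasurable_fun_infty_o.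
case: (norm_nu) => _ _ nuD.
apply/seteqP; split => [[x y] /=|[x y] [q _] /=]; rewrite -?EFinD !lte_fin.
- rewrite -subr_gt0 => axy.
  have [q xq] := @rational_dense x _ (divr_gt0 axy (ltr0n _ 2)).
  exists q => //=; rewrite -EFinD lte_fin.
  have := nuD (y - x)%R (x - map_mx ratr q)%R; rewrite addrA subrK.
  rewrite -[nu (y - x)%R](is_normN norm_nu) opprB; lra.
- move=> h; apply: le_lt_trans h.
  have := nuD (x - map_mx ratr q)%R (map_mx ratr q - y)%R; rewrite addrA subrK.
  by rewrite -[nu (map_mx _ _ - y)%R](is_normN norm_nu) opprB.
Qed.

End borel_measurability.

(** * Finitely supported measures and marginals of couplings *)

Section finitely_supported.
Context {R : realType} {d : measure_display} {T : measurableType d}.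
Context {I : finType} (w : I -> R) (a : I -> T).
Hypothesis w_ge0 : forall i, (0 <= w i)%R.

(* [msum] sums a sequence of measures, so the finite type is enumerated and the
   sequence is extended by the zero measure. *)
Let atom (k : nat) : {measure set T -> \bar R} :=
  if (insub k : option 'I_#|I|) is Some j
  then mscale (NngNum (w_ge0 (enum_val j))) (dirac (a (enum_val j)))
  else mzero.

Let atomE (j : 'I_#|I|) :
  atom j = mscale (NngNum (w_ge0 (enum_val j))) (dirac (a (enum_val j))).
Proof. by rewrite /atom valK. Qed.

Let msum_atomE A : msum atom #|I| A = \sum_i (w i)%:E * \d_(a i) A.
Proof.
rewrite /msum [RHS](big_enum_val (A := I)); apply: eq_bigr => j _.
by rewrite atomE /mscale/=.
Qed.

Lemma integral_finitely_supported (mu : {measure set T -> \bar R})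
    (f : T -> \bar R) :
  (forall A, measurable A -> mu A = \sum_i (w i)%:E * \d_(a i) A) ->
  measurable_fun setT f -> (forall x, 0 <= f x) ->
  \int[mu]_x f x = \sum_i (w i)%:E * f (a i).
Proof.
move=> muE mf f0.
rewrite (eq_measure_integral (msum atom #|I|)); last first.
  by move=> A mA _; rewrite muE//; exact/esym/msum_atomE.
rewrite ge0_integral_measure_sum// [RHS](big_enum_val (A := I)).
apply: eq_bigr => j _; rewrite atomE ge0_integral_mscale// integral_dirac//.
by rewrite diracT mul1e.
Qed.

Lemma exists_finitely_supported : (\sum_i w i = 1)%R ->
  exists P : probability T R, forall A, P A = \sum_i (w i)%:E * \d_(a i) A.
Proof.
move=> w1.
have P1 : msum atom #|I| setT = 1.
  rewrite msum_atomE -[RHS]/(1%R%:E) -w1 -sumEFin; apply: eq_bigr => i _.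
  by rewrite diracT mule1.
pose mix := Measure_isProbability.Build _ _ _ (msum atom #|I|) P1.
pose P : probability T R := HB.pack (msum atom #|I|) mix.
by exists P => A; exact: msum_atomE.
Qed.

End finitely_supported.

Section coupling_integrals.
Context {R : realType} {m N : nat} (xi : 'I_N -> 'rV[R]_m).
Implicit Types (Q : probability (borel_rV R m) R) (f : borel_rV R m -> \bar R)
  (P : probability (borel_rV R m * borel_rV R m)%type R).

Lemma empiricalE A :
  empirical xi A = \sum_i (N%:R^-1)%:E * \d_(xi i : borel_rV R m) A.
Proof. by rewrite /empirical ge0_sume_distrr. Qed.

Lemma integral_empirical f :
  measurable_fun setT f -> (forall x, 0 <= f x) ->
  \int[empirical xi]_x f x = \sum_i (N%:R^-1)%:E * f (xi i).
Proof.
move=> mf f0.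
apply: (integral_finitely_supported (a := xi : 'I_N -> borel_rV R m)) => //.
by move=> A _; exact: empiricalE.
Qed.

Context (mu1 mu2 : {measure set (borel_rV R m) -> \bar R}).

Lemma coupling_integral_fst P f : coupling mu1 mu2 P ->
  measurable_fun setT f -> (forall x, 0 <= f x) ->
  \int[P]_p f p.1 = \int[mu1]_x f x.
Proof.
move=> cP mf f0.
rewrite [RHS](eq_measure_integral (pushforward P fst)); last first.
  by move=> A mA _; rewrite -(cP A mA).1.
by rewrite ge0_integral_pushforward.
Qed.

Lemma coupling_integral_snd P f : coupling mu1 mu2 P ->
  measurable_fun setT f -> (forall x, 0 <= f x) ->
  \int[P]_p f p.2 = \int[mu2]_x f x.
Proof.
move=> cP mf f0.
rewrite [RHS](eq_measure_integral (pushforward P snd)); last first.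
  by move=> A mA _; rewrite -(cP A mA).2.
by rewrite ge0_integral_pushforward.
Qed.

Lemma coupling_ae_fst P (B : borel_rV R m -> Prop) : coupling mu1 mu2 P ->
  {ae mu1, forall x, B x} -> {ae P, forall p, B p.1}.
Proof.
move=> cP [A [mA A0 BA]]; exists (fst @^-1` A); split.
- by rewrite -[X in measurable X]setTI; exact: measurable_fst.
- by rewrite -A0; exact: (cP A mA).1.
- by move=> p /= np; apply: BA.
Qed.

Lemma coupling_ae_snd P (B : borel_rV R m -> Prop) : coupling mu1 mu2 P ->
  {ae mu2, forall x, B x} -> {ae P, forall p, B p.2}.
Proof.
move=> cP [A [mA A0 BA]]; exists (snd @^-1` A); split.
- by rewrite -[X in measurable X]setTI; exact: measurable_snd.
- by rewrite -A0; exact: (cP A mA).2.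
- by move=> p /= np; apply: BA.
Qed.

Lemma empirical_ae_data :
  {ae empirical xi, forall x : borel_rV R m, exists i, x = xi i}.
Proof.
have mx i : measurable ([set xi i] : set (borel_rV R m)).
  rewrite -[X in measurable X]setCK; apply: measurableC.
  apply: sub_sigma_algebra; rewrite openC.
  exact: accessible_closed_set1 (@hausdorff_accessible _ (@norm_hausdorff _ _)) _.
exists (~` \bigcup_(i in [set: 'I_N]) [set xi i : borel_rV R m]); split.
- by apply: measurableC; exact: fin_bigcup_measurable.
- rewrite empiricalE big1// => i _; rewrite diracE memNset ?mule0//.
  by apply; exists i.
- move=> x nx [i _ xE]; apply: nx; by exists i.
Qed.

End coupling_integrals.

(** * Integrating a Lipschitz bound against a coupling *)

Lemma maxr0_subN {R : realDomainType} (t : R) :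
  (Num.max t 0 - Num.max (- t) 0 = t)%R.
Proof. by case: (leP t 0%R) => ?; case: (leP (- t)%R 0%R) => ?; lra. Qed.

(** The hypothesis u - v <= f - g + h is stated without subtraction, since the
    integrals of u and v may be infinite. The separate bound u <= f + h makes the
    integral of u finite, so that the ambiguous case +oo - oo does not occur. *)
Lemma integral_sub_le {d : measure_display} {T : measurableType d}
    {R : realType} (mu : {measure set T -> \bar R}) (u v f g h : T -> \bar R)
    (F G H : R) :
  measurable_fun setT u -> measurable_fun setT v -> measurable_fun setT f ->
  measurable_fun setT g -> measurable_fun setT h ->
  (forall x, 0 <= u x) -> (forall x, 0 <= v x) -> (forall x, 0 <= f x) ->
  (forall x, 0 <= g x) -> (forall x, 0 <= h x) ->
  \int[mu]_x f x = F%:E -> \int[mu]_x g x = G%:E -> \int[mu]_x h x <= H%:E ->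
  {ae mu, forall x, u x <= f x + h x /\ u x + g x <= v x + (f x + h x)} ->
  (\int[mu]_x u x - \int[mu]_x v x)%dE <= (H + (F - G))%:E.
Proof.
move=> mu_ mv mf mg mh u0 v0 f0 g0 h0 intf intg inth [A [mA A0 sA]].
have mfh : measurable_fun setT (fun x => f x + h x) by exact: emeasurable_funD.
have fh0 x : 0 <= f x + h x by exact: adde_ge0.
have intfh : \int[mu]_x (f x + h x) <= (F + H)%:E.
  by rewrite ge0_integralD// intf EFinD leeD2l.
have bound1 : \int[mu]_x u x <= (F + H)%:E.
  apply: le_trans intfh; apply: ae_ge0_le_integral => //.
  exists A; split => // x nx; apply: sA => /= -[ux _].
  by apply: nx => _.
have bound2 : \int[mu]_x u x + G%:E <= \int[mu]_x v x + (F + H)%:E.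
  rewrite -intg -ge0_integralD//.
  apply: (@le_trans _ _ (\int[mu]_x (v x + (f x + h x)))); last first.
    by rewrite ge0_integralD// leeD2l.
  apply: ae_ge0_le_integral => //.
  - by move=> x _; exact: adde_ge0.
  - exact: emeasurable_funD.
  - by move=> x _; exact: adde_ge0.
  - exact: emeasurable_funD.
  - exists A; split => // x nx; apply: sA => /= -[_ ux].
    by apply: nx => _.
move: bound1 bound2.
have : 0 <= \int[mu]_x u x by exact: integral_ge0.
case: (\int[mu]_x u x) => [a| |]//.
case: (\int[mu]_x v x) => [b| |] _ //=.
- by rewrite (_ : (a%:E - b%:E)%dE = (a - b)%:E)// -!EFinD !lee_fin; lra.
- by rewrite leNye.
Qed.

Section lipschitz_transport.
Context {R : realType} {m N : nat} (nu : 'rV[R]_m -> R)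
  (xi : 'I_N -> 'rV[R]_m) (l : 'rV[R]_m -> \bar R).
Hypotheses (norm_nu : is_norm nu) (lNy : forall x, -oo < l x)
  (lsc_l : lower_semicontinuous l).
Implicit Types (Q : probability (borel_rV R m) R)
  (P : probability (borel_rV R m * borel_rV R m)%type R).

Local Notation cost P :=
  (\int[P]_p (nu ((p.1 : 'rV[R]_m) - p.2)%R)%:E).

(** The two parts are kept apart because [expect] subtracts their integrals with
    the convention +oo - oo = +oo, unlike the integral of l itself. *)
Definition pos_part (x : borel_rV R m) := maxe (l x) 0.
Definition neg_part (x : borel_rV R m) := maxe (- l x) 0.

Lemma pos_part_ge0 x : 0 <= pos_part x.
Proof. by rewrite le_max lexx orbT. Qed.

Lemma neg_part_ge0 x : 0 <= neg_part x.
Proof. by rewrite le_max lexx orbT. Qed.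

Lemma measurable_pos_part : measurable_fun setT pos_part.
Proof. by apply: measurable_maxe => //; exact: lsc_borel_measurable. Qed.

Lemma measurable_neg_part : measurable_fun setT neg_part.
Proof.
apply: measurable_maxe => //; apply: measurableT_comp => //.
exact: lsc_borel_measurable.
Qed.

Lemma expectE Q :
  expect Q l = (\int[Q]_x pos_part x - \int[Q]_x neg_part x)%dE.
Proof.
rewrite /expect; congr (_ + _)%dE.
rewrite -integral_ge0N => [|x _]; last exact: neg_part_ge0.
by apply: eq_integral => x _; rewrite /neg_part oppe_max oppeK oppe0.
Qed.

(** Along a coupling, p.1 is almost surely a data point, so l(p.2) is compared
    with l(p.1) there, and the excess L nu(p.1 - p.2) integrates to L times the
    cost. *)
Lemma expect_le_lipschitz Q P (b : 'I_N -> R) (L c : R) :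
  (0 <= L)%R -> (forall i, l (xi i) = (b i)%:E) ->
  {ae Q, forall x : borel_rV R m, forall i,
    l x <= (b i + L * nu (xi i - x)%R)%:E} ->
  coupling (empirical xi) Q P -> cost P <= c%:E ->
  expect Q l <= (L * c + N%:R^-1 * \sum_i b i)%:E.
Proof.
move=> L0 lb lipQ cP costc.
have cost_ge0 (p : borel_rV R m * borel_rV R m) :
  0 <= (nu ((p.1 : 'rV[R]_m) - p.2)%R)%:E by rewrite lee_fin; exact: is_norm_ge0.
have mcost := measurable_norm_diff norm_nu.
have mLcost : measurable_fun [set: borel_rV R m * borel_rV R m]
    (fun p => L%:E * (nu ((p.1 : 'rV[R]_m) - p.2)%R)%:E).
  by apply: measurable_funeM.
have Lcost_ge0 (p : borel_rV R m * borel_rV R m) :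
  0 <= L%:E * (nu ((p.1 : 'rV[R]_m) - p.2)%R)%:E.
  by apply: mule_ge0 => //; rewrite lee_fin.
have mfst := @measurable_fst _ _ (borel_rV R m) (borel_rV R m).
have msnd := @measurable_snd _ _ (borel_rV R m) (borel_rV R m).
have mpos1 := measurableT_comp measurable_pos_part mfst.
have mpos2 := measurableT_comp measurable_pos_part msnd.
have mneg1 := measurableT_comp measurable_neg_part mfst.
have mneg2 := measurableT_comp measurable_neg_part msnd.
have lipP : {ae P, forall p, exists2 i, p.1 = xi i &
    l p.2 <= (b i + L * nu ((p.1 : 'rV[R]_m) - p.2)%R)%:E}.
  have := coupling_ae_fst cP (empirical_ae_data xi).
  have := coupling_ae_snd cP lipQ.
  apply: filterS2 => p lp [i pi]; exists i => //.
  by rewrite pi; exact: lp.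
pose Ap := (N%:R^-1 * \sum_i Num.max (b i) 0)%R.
pose An := (N%:R^-1 * \sum_i Num.max (- b i) 0)%R.
have AE : (Ap - An = N%:R^-1 * \sum_i b i)%R.
  rewrite /Ap /An -mulrBr -sumrB; congr (_ * _)%R; apply: eq_bigr => i _.
  exact: maxr0_subN.
have posP1 : \int[P]_p pos_part p.1 = Ap%:E.
  rewrite (coupling_integral_fst cP measurable_pos_part pos_part_ge0).
  rewrite (integral_empirical _ measurable_pos_part pos_part_ge0).
  rewrite /Ap mulr_sumr -sumEFin; apply: eq_bigr => i _.
  by rewrite EFinM /pos_part lb EFin_max.
have negP1 : \int[P]_p neg_part p.1 = An%:E.
  rewrite (coupling_integral_fst cP measurable_neg_part neg_part_ge0).
  rewrite (integral_empirical _ measurable_neg_part neg_part_ge0).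
  rewrite /An mulr_sumr -sumEFin; apply: eq_bigr => i _.
  by rewrite EFinM /neg_part lb EFin_max.
have posP2 := coupling_integral_snd cP measurable_pos_part pos_part_ge0.
have negP2 := coupling_integral_snd cP measurable_neg_part neg_part_ge0.
rewrite expectE -posP2 -negP2 -AE.
apply: (integral_sub_le mpos2 mneg2 mpos1 mneg1 mLcost) => //.
- by move=> p; exact: pos_part_ge0.
- by move=> p; exact: neg_part_ge0.
- by move=> p; exact: pos_part_ge0.
- by move=> p; exact: neg_part_ge0.
- by rewrite ge0_integralZl_EFin// EFinM lee_wpmul2l.
have [A [mA A0 sA]] := lipP; exists A; split => // p np; apply: sA => /= -[i pi lp].
apply: np => /=; rewrite /pos_part /neg_part pi lb; move: lp (lNy p.2); rewrite pi.
have := is_norm_ge0 norm_nu (xi i - p.2)%R; set nui := nu _ => nui0.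
have Lnu : (0 <= L * nui)%R by exact: mulr_ge0.
case: (l p.2) => [t| |]//; rewrite lee_fin => lt _.
have := maxr0_subN t; have := maxr0_subN (b i).
rewrite -!EFinN -!EFin_max -EFinM -!EFinD !lee_fin => bE tE; split; last lra.
rewrite ge_max addr_ge0 ?le_max ?lexx ?orbT// andbT (le_trans lt)// lerD2r.
by rewrite le_max lexx.
Qed.

End lipschitz_transport.

(** * The upper bound *)

Section distance_to_data.
Context {R : realType} {m N : nat} (nu : 'rV[R]_m -> R)
  (xi : 'I_N -> 'rV[R]_m).
Hypothesis norm_nu : is_norm nu.
Implicit Types (Q : probability (borel_rV R m) R).

Lemma near_optimal_coupling (mu1 mu2 : {measure set (borel_rV R m) -> \bar R})
    (e d : R) : wasserstein nu mu1 mu2 <= e%:E -> (0 < d)%R ->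
  exists2 P, coupling mu1 mu2 P &
    \int[P]_p (nu ((p.1 : 'rV[R]_m) - p.2)%R)%:E <= (e + d)%:E.
Proof.
move=> we d0.
have /ereal_inf_lt[_ [P cP <-] /ltW Pd] : wasserstein nu mu1 mu2 < (e + d)%:E.
  by apply: le_lt_trans we _; rewrite lte_fin ltrDl.
by exists P.
Qed.

Lemma expect_le_wasserstein Q (l : 'rV[R]_m -> \bar R) (b : 'I_N -> R) (L e : R) :
  (forall x, -oo < l x) -> lower_semicontinuous l ->
  (0 <= L)%R -> (forall i, l (xi i) = (b i)%:E) ->
  {ae Q, forall x : borel_rV R m, forall i,
    l x <= (b i + L * nu (xi i - x)%R)%:E} ->
  wasserstein nu (empirical xi) Q <= e%:E ->
  expect Q l <= (L * e + N%:R^-1 * \sum_i b i)%:E.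
Proof.
move=> lNy lsc_l L0 lb lipQ we; apply/lee_addgt0Pr => d d0.
have L1 : (0 < L + 1)%R by lra.
have [P cP costP] := near_optimal_coupling we (divr_gt0 d0 L1).
apply: le_trans (expect_le_lipschitz norm_nu lNy lsc_l L0 lb lipQ cP costP) _.
rewrite -EFinD lee_fin mulrDr addrAC lerD2l.
by rewrite mulrCA ler_piMr ?ltW// ltr_pdivrMr// mul1r ltrDl.
Qed.

Definition dist_data (x : borel_rV R m) : \bar R :=
  \big[mine/+oo]_i (nu ((x : 'rV[R]_m) - xi i)%R)%:E.

Lemma measurable_dist_data : measurable_fun setT dist_data.
Proof.
rewrite /dist_data; elim: (index_enum _) => [|i s ih].
  by under eq_fun do rewrite big_nil; exact: measurable_cst.
under eq_fun do rewrite big_cons; apply: measurable_mine => //.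
exact: (continuous_borel_measurable (is_norm_continuous norm_nu (y := xi i))).
Qed.

Lemma dist_data_ge0 x : 0 <= dist_data x.
Proof.
by apply/bigmin_geP; split => [|i _]; rewrite ?leey// lee_fin; exact: is_norm_ge0.
Qed.

(** For any coupling, the distance from p.2 to the data is at most
    nu(p.1 - p.2), so its integral with respect to Q is at most every transport
    cost, hence zero. *)
Lemma wasserstein_eq0 Q : wasserstein nu (empirical xi) Q <= 0 ->
  {ae Q, forall x : borel_rV R m, exists i, x = xi i}.
Proof.
move=> w0.
have int0 : \int[Q]_x dist_data x <= 0.
  apply/lee_addgt0Pr => d d0.
  have [P cP costP] := near_optimal_coupling w0 d0.
  rewrite add0r in costP; rewrite add0e; apply: le_trans costP.
  rewrite -(coupling_integral_snd cP measurable_dist_data dist_data_ge0).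
  apply: ae_ge0_le_integral => //.
  - by move=> p _; exact: dist_data_ge0.
  - exact: (measurableT_comp measurable_dist_data).
  - by move=> p _; rewrite lee_fin; exact: is_norm_ge0.
  - exact: measurable_norm_diff.
  have [A [mA A0 sA]] := coupling_ae_fst cP (empirical_ae_data xi).
  exists A; split => // p np; apply: sA => /= -[i pi].
  apply: np => _; apply: (@bigmin_inf _ _ _ _ i) => //=.
  by rewrite pi lee_fin -[leLHS](is_normN norm_nu) opprB.
have : \int[Q]_x `|dist_data x| = 0.
  apply/eqP; rewrite eq_le; apply/andP; split; last exact: integral_ge0.
  by under eq_integral do rewrite gee0_abs ?dist_data_ge0//.
move=> /(ae_eq_integral_abs Q measurableT measurable_dist_data).
move=> [A [mA A0 sA]]; exists A; split => // x nx; apply: sA => /= dx.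
apply: nx; apply: contrapT => nx.
have : 0 < dist_data x.
  apply/bigmin_gtP; split => [|i _]; first exact: ltry.
  rewrite lte_fin lt_neqAle (is_norm_ge0 norm_nu) andbT eq_sym; apply/eqP => nui.
  apply: nx; exists i; apply/eqP; rewrite -subr_eq0; apply/eqP.
  by case: norm_nu => + _ _; apply.
by rewrite dx// ltxx.
Qed.

Context (l : 'rV[R]_m -> \bar R).
Hypotheses (proper_l : proper_fun l) (convex_l : convex_efun l)
  (lsc_l : lower_semicontinuous l).

(** The sum of all slopes dominates each of them; when two data points coincide
    the quotient is 0 by convention, which is harmless because the values of l
    coincide as well. *)
Lemma data_slope (b : 'I_N -> R) : (forall i, l (xi i) = (b i)%:E) ->
  exists2 L : R, (0 <= L)%R & forall i j, (b j <= b i + L * nu (xi i - xi j)%R)%R.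
Proof.
move=> lb; pose s i j := (`|b j - b i| / nu (xi i - xi j))%R.
have s0 i j : (0 <= s i j)%R by apply: divr_ge0 => //; exact: is_norm_ge0.
exists (\sum_i \sum_j s i j)%R.
  by apply: sumr_ge0 => i _; exact: sumr_ge0.
move=> i j; have [nuij|nuij] := eqVneq (nu (xi i - xi j)%R) 0%R.
  have : (xi i = xi j)%R.
    apply/eqP; rewrite -subr_eq0; apply/eqP.
    by case: norm_nu => + _ _; apply.
  move=> xij; have [->] : (b j)%:E = (b i)%:E by rewrite -!lb xij.
  by rewrite nuij mulr0 addr0.
rewrite -lerBlDl; apply: le_trans (ler_norm _) _.
have -> : (`|b j - b i| = s i j * nu (xi i - xi j))%R by rewrite divfK.
apply: ler_wpM2r; first exact: is_norm_ge0.
rewrite (bigD1 i)//= (bigD1 j)//= -addrA lerDl addr_ge0//; first exact: sumr_ge0.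
by apply: sumr_ge0 => k _; exact: sumr_ge0.
Qed.

Lemma sum_data_pinfty i : l (xi i) = +oo -> \sum_i l (xi i) = +oo.
Proof.
move=> li; apply/eqP; rewrite esum_eqy; last first.
  by move=> j _; rewrite gt_eqF// proper_l.2.
by apply/existsP; exists i; rewrite li eqxx.
Qed.

Lemma data_finite : (forall i, l (xi i) != +oo) ->
  exists b : 'I_N -> R, forall i, l (xi i) = (b i)%:E.
Proof.
move=> lfin; exists (fun i => fine (l (xi i))) => i.
by rewrite fineK// fin_numE lfin andbT gt_eqF// proper_l.2.
Qed.

(** When kappa = +oo the bound is informative only for e = 0, where kappa * e = 0
    and l is Lipschitz on the data points alone. *)
Lemma worst_case_le Xi (e : R) : (0 < N)%N -> (0 <= e)%R ->
  worst_case nu Xi xi e l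
    <= kappa nu l * e%:E + (N%:R^-1)%:E * \sum_(i < N) l (xi i).
Proof.
move=> N0 e0; apply: ge_ereal_sup => _ [Q [_ we] <-].
have Nr0 : (0 < N%:R^-1 :> R)%R by rewrite invr_gt0 ltr0n.
have kappa0 := kappa_ge0 proper_l convex_l lsc_l norm_nu.
have [/existsP[i /eqP li]|/existsPn lfin] := boolP [exists i, l (xi i) == +oo].
  rewrite (sum_data_pinfty li) gt0_muley// addey ?leey//.
  by rewrite gt_eqF// (lt_le_trans _ (mule_ge0 kappa0 _))// lee_fin.
have [//|b lb] := data_finite.
have -> : (N%:R^-1)%:E * \sum_(i < N) l (xi i) = (N%:R^-1 * \sum_i b i)%:E.
  by under eq_bigr do rewrite lb; rewrite sumEFin.
move: kappa0; case E : (kappa nu l) => [K| |]// K0.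
  rewrite -EFinM -EFinD; apply: expect_le_wasserstein we => //.
  - exact: proper_l.2.
  - apply: aeW => x i; have := kappa_lipschitz proper_l convex_l lsc_l norm_nu x (xi i) E.
    by rewrite lb -EFinD -[nu (x - _)%R](is_normN norm_nu) opprB.
have [e00|ne0] := eqVneq e 0%R; last first.
  have ep : (0 < e)%R by rewrite lt_neqAle eq_sym ne0.
  by rewrite gt0_mulye// addye// leey.
rewrite e00 mule0 add0e in we *.
have [L L0 bL] := data_slope lb.
have [A [mA A0 sA]] := wasserstein_eq0 we.
rewrite -[(_ * _)%R]add0r -[X in (X + _)%R](mulr0 L).
apply: expect_le_wasserstein we => //; first exact: proper_l.2.
exists A; split => // x nx; apply: sA => /= -[j xj].
by apply: nx => i; rewrite xj lb lee_fin.
Qed.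

End distance_to_data.

(** * The lower bound *)

Section lower_bound.
Context {R : realType} {m N : nat} (nu : 'rV[R]_m -> R)
  (xi : 'I_N -> 'rV[R]_m) (l : 'rV[R]_m -> \bar R).
Hypotheses (norm_nu : is_norm nu) (proper_l : proper_fun l)
  (convex_l : convex_efun l) (lsc_l : lower_semicontinuous l).
Implicit Types (Q : probability (borel_rV R m) R).

(** The negative part is finite at every atom because l > -oo, so the dual
    difference of integrals is an ordinary sum. *)
Lemma expect_finitely_supported (I : finType) (w : I -> R)
    (a : I -> borel_rV R m) Q :
  (forall i, 0 <= w i)%R ->
  (forall A, measurable A -> Q A = \sum_i (w i)%:E * \d_(a i) A) ->
  expect Q l = \sum_i (w i)%:E * l (a i).
Proof.
move=> w0 QE; have [_ lNy] := proper_l; rewrite expectE.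
have mpos := measurable_pos_part lsc_l; have mneg := measurable_neg_part lsc_l.
rewrite (integral_finitely_supported w0 QE mpos (pos_part_ge0 l)).
rewrite (integral_finitely_supported w0 QE mneg (neg_part_ge0 l)).
pose v i := fine (neg_part l (a i)).
have vE i : neg_part l (a i) = (v i)%:E.
  rewrite /v fineK// fin_numE gt_eqF ?(lt_le_trans _ (neg_part_ge0 _ _))//=.
  rewrite /neg_part; have := lNy (a i); case: (l (a i)) => [t| |]// _.
    by rewrite /= -EFin_max.
  by rewrite max_r ?leNye.
have -> : \sum_i (w i)%:E * neg_part l (a i) = (\sum_i w i * v i)%:E.
  by rewrite -sumEFin; apply: eq_bigr => i _; rewrite vE.
have dsub (x : \bar R) (y : R) : (x - y%:E)%dE = x - y%:E by case: x.
rewrite dsub -EFinN -sumrN -sumEFin -big_split; apply: eq_bigr => i _ /=.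
have <- : pos_part l (a i) - (v i)%:E = l (a i).
  rewrite -vE /pos_part /neg_part; have := lNy (a i).
  case: (l (a i)) => [t| |]// _.
    by rewrite -!EFinN -!EFin_max -EFinB maxr0_subN.
  by rewrite max_l ?leey// max_r ?leNye// sube0.
by rewrite muleBr// ?fin_num_adde_defl// -EFinM.
Qed.

(** The coupling has atoms (xi_i, xi_i) of mass (1 - s)/N and (xi_i, xi_i + v) of
    mass s/N; the boolean index tells them apart. *)
Lemma shifted_data_in_wball (s e : R) (v : 'rV[R]_m) :
  (0 < N)%N -> (0 <= s <= 1)%R -> (s * nu v <= e)%R ->
  exists2 Q, wball nu setT xi e Q &
    expect Q l = \sum_(i < N) ((N%:R^-1 * (1 - s))%:E * l (xi i) +
                               (N%:R^-1 * s)%:E * l (xi i + v)%R).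
Proof.
move=> N0 /andP[s0 s1] sv.
have Nr0 : (N%:R != 0 :> R)%R by rewrite pnatr_eq0 -lt0n.
have Ninv : (0 <= N%:R^-1 :> R)%R by rewrite invr_ge0.
pose w (p : 'I_N * bool) := (N%:R^-1 * (if p.2 then s else 1 - s))%R.
pose a (p : 'I_N * bool) : borel_rV R m := xi p.1.
pose b (p : 'I_N * bool) : borel_rV R m := if p.2 then (xi p.1 + v)%R else xi p.1.
have w0 p : (0 <= w p)%R by apply: mulr_ge0 => //; case: (p.2) => //; rewrite subr_ge0.
have sum_pairs (F : 'I_N * bool -> \bar R) :
    \sum_p F p = \sum_i (F (i, false) + F (i, true)).
  rewrite (eq_bigr (fun p => F (p.1, p.2))); last by move=> [].
  rewrite -(pair_bigA _ (fun i c => F (i, c)))/=; apply: eq_bigr => i _.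
  by rewrite big_bool addeC.
have w1 : (\sum_p w p = 1)%R.
  apply: EFin_inj; rewrite -sumEFin sum_pairs.
  under eq_bigr => i _ do rewrite /w/= -EFinD -mulrDr subrK mulr1.
  rewrite sumEFin sumr_const card_ord -[LHS]/((_ *+ N)%R%:E).
  by rewrite -[(_ *+ N)%R]mulr_natl divff.
have [Q QE] := exists_finitely_supported b w0 w1.
have [P PE] := exists_finitely_supported (fun p => (a p, b p)) w0 w1.
exists Q; last first.
  rewrite (expect_finitely_supported w0 (fun A _ => QE A)) sum_pairs.
  by apply: eq_bigr => i _.
have mnu : measurable_fun [set: borel_rV R m] (fun x : borel_rV R m => (nu x)%:E).
  have := continuous_borel_measurable (is_norm_continuous norm_nu (y := 0%R)).
  by under eq_fun do rewrite subr0.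
split.
  split; first by apply: aeW.
  rewrite (integral_finitely_supported w0 (fun A _ => QE A) mnu); last first.
    by move=> x; rewrite lee_fin; exact: is_norm_ge0.
  by under eq_bigr do rewrite -EFinM; rewrite sumEFin ltry.
apply: (@le_trans _ _ (\int[P]_p (nu ((p.1 : 'rV[R]_m) - p.2)%R)%:E)).
  apply: ereal_inf_lbound; exists P => // A mA; split.
    rewrite PE [RHS]empiricalE sum_pairs; apply: eq_bigr => i _.
    rewrite !diracE /w /=.
    have -> : ((a (i, false), b (i, false)) \in fst @^-1` A) = (xi i \in A).
      by apply/idP/idP; rewrite !inE.
    have -> : ((a (i, true), b (i, true)) \in fst @^-1` A) = (xi i \in A).
      by apply/idP/idP; rewrite !inE.
    by rewrite -!EFinM -EFinD -mulrDl -mulrDr subrK mulr1.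
  rewrite PE [RHS]QE; apply: eq_bigr => p _; rewrite !diracE.
  have -> // : ((a p, b p) \in snd @^-1` A) = (b p \in A).
  by apply/idP/idP; rewrite !inE.
rewrite (integral_finitely_supported w0 (fun A _ => PE A)); last 2 first.
- exact: measurable_norm_diff.
- by move=> p; rewrite lee_fin; exact: is_norm_ge0.
rewrite sum_pairs.
under eq_bigr => i _.
  rewrite /= /a /b /= subrr (is_norm0 norm_nu) mule0 add0e opprD addNKr.
  rewrite (is_normN norm_nu) /w /= -EFinM -mulrA.
  over.
rewrite sumEFin lee_fin sumr_const card_ord -mulrnAl -[(_ *+ N)%R]mulr_natl.
by rewrite divff// mul1r.
Qed.

(** With s = 0 the shifted measure is the empirical one, which settles the cases
    e = 0 and l(xi_i) = +oo. Otherwise use v = (e / s) u and let s tend to 0. *)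
Lemma worst_case_ge (e : R) : (0 < N)%N -> (0 <= e)%R ->
  kappa nu l * e%:E + (N%:R^-1)%:E * \sum_(i < N) l (xi i)
    <= worst_case nu setT xi e l.
Proof.
move=> N0 e0; set W := worst_case _ _ _ _ _.
have Nr0 : (0 < N%:R^-1 :> R)%R by rewrite invr_gt0 ltr0n.
have shifted (s : R) v : (0 <= s <= 1)%R -> (s * nu v <= e)%R ->
    \sum_(i < N) ((N%:R^-1 * (1 - s))%:E * l (xi i) +
                  (N%:R^-1 * s)%:E * l (xi i + v)%R) <= W.
  move=> s01 sv; have [Q QB <-] := shifted_data_in_wball N0 s01 sv.
  by apply: ereal_sup_ubound; exists Q.
have meanW : (N%:R^-1)%:E * \sum_(i < N) l (xi i) <= W.
  have := shifted 0%R 0%R; rewrite lexx ler01 mul0r => /(_ isT e0).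
  congr (_ <= _); rewrite fin_num_sume_distrr//; last first.
    move=> i j _ _; have := proper_l.2 (xi i); have := proper_l.2 (xi j).
    by case: (l (xi i)); case: (l (xi j)).
  by apply: eq_bigr => i _; rewrite subr0 mulr1 mulr0 mul0e adde0.
have [/existsP[i /eqP li]|/existsPn lfin] := boolP [exists i, l (xi i) == +oo].
  move: meanW; rewrite (sum_data_pinfty proper_l li) gt0_muley// leye_eq => /eqP ->.
  by rewrite leey.
have [//|b lb] := data_finite proper_l (xi := xi).
pose M := (N%:R^-1 * \sum_i b i)%R.
have meanE : (N%:R^-1)%:E * \sum_(i < N) l (xi i) = M%:E.
  by under eq_bigr do rewrite lb; rewrite sumEFin.
rewrite meanE in meanW *.
have [->|ne0] := eqVneq e 0%R; first by rewrite mule0 add0e.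
have ep : (0 < e)%R by rewrite lt_neqAle eq_sym ne0.
case EW : W => [r| |]; [|by rewrite leey|by move: meanW; rewrite EW].
suff : kappa nu l <= ((r - M) / e)%:E.
  move=> kr; rewrite -leeBrDr// -EFinB -lee_pdivlMr//.
apply: ge_ereal_sup => _ [th thfin <-].
apply: ge_ereal_sup => _ [u u1 <-]; rewrite lee_fin ler_pdivlMr//.
have [c thc] := conjugate_minorant proper_l thfin.
(* s C is the loss caused by replacing l with the affine minorant only on the
   moved mass, hence of order s. *)
pose C := (N%:R^-1 * \sum_i (inner th (xi i) - c - b i))%R.
rewrite -subr_ge0; apply: (@ge0_of_small_steps _ _ `|C|%R 1%R) => // s.
move=> /andP[s0 s1].
have su : (s * nu (e / s *: u) <= e)%R.
  have [_ -> _] := norm_nu; rewrite ger0_norm; last by rewrite divr_ge0// ltW.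
  by rewrite mulrA mulrCA divff ?gt_eqF// mulr1 ger_pMr.
have s01 : (0 <= s <= 1)%R by rewrite ltW.
have := shifted s (e / s *: u)%R s01 su; rewrite EW.
have low : (M + s * C + e * inner th u)%:E <=
    \sum_(i < N) ((N%:R^-1 * (1 - s))%:E * l (xi i) +
                  (N%:R^-1 * s)%:E * l (xi i + e / s *: u)%R).
  have -> : (M + s * C + e * inner th u = \sum_(i < N) (N%:R^-1 *
     ((1 - s) * b i + s * (inner th (xi i + e / s *: u)%R - c))))%R.
    rewrite -mulr_sumr.
    under eq_bigr => i _.
      rewrite innerDr innerZr.
      have -> : ((1 - s) * b i + s * (inner th (xi i) + e / s * inner th u - c) =
        b i + s * (inner th (xi i) - c - b i) + e * inner th u)%R.
        by field; rewrite gt_eqF.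
      over.
    rewrite !big_split/= sumr_const card_ord -mulr_sumr /M /C.
    rewrite -[(_ *+ N)%R]mulr_natl; field.
    by rewrite pnatr_eq0 -lt0n.
  rewrite -sumEFin; apply: lee_sum => i _.
  rewrite lb mulrDr EFinD !mulrA EFinM [X in _ + X]EFinM EFinM leeD2l//.
  by apply: lee_wpmul2l; rewrite ?thc// lee_fin mulr_ge0 ?ltW.
move=> /(le_trans low); rewrite lee_fin.
have := ler_norm (- C)%R; rewrite normrN => CN.
have : (s * - C <= s * `|C|)%R by rewrite ler_pM2l.
lra.
Qed.

End lower_bound.

Unset Implicit Arguments.

Theorem theorem6p3 (R : realType) (m N : nat) (nu : 'rV[R]_m -> R)
  (Xi : set 'rV[R]_m) (xi : 'I_N -> 'rV[R]_m) (l : 'rV[R]_m -> \bar R) (e : R)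
  (hN : (0 < N)%N)
  (hnu : is_norm nu)
  (hxi : forall i, Xi (xi i))
  (hproper : proper_fun l)
  (hconvex : convex_efun l)
  (hlsc : lower_semicontinuous l)
  (he : (0 <= e)%R) :
  worst_case nu Xi xi e l
    <= kappa nu l * e%:E + (N%:R^-1)%:E * \sum_(i < N) l (xi i)
  /\ (Xi = setT ->
      worst_case nu Xi xi e l
        = kappa nu l * e%:E + (N%:R^-1)%:E * \sum_(i < N) l (xi i)).
Proof.
split=> [|->]; first exact: worst_case_le.
by apply/eqP; rewrite eq_le worst_case_le//= worst_case_ge.
Qed.
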